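(* Let $G$ be a finite simple graph without isolated vertices (and with at least one edge), and let $f_0$ and $f_1$ denote the number of vertices and edges of the edge polytope $\mathcal{P}(G)$. Then \[ f_0^{3/2}-f_0\le f_1. \] Equality holds if and only if $G$ is a complete bipartite graph with parts of equal size.
   Context: All graphs are finite, undirected, without loops, multiple edges or isolated vertices. For a graph $G$ on vertex set $[n]$, the edge polytope is $\mathcal{P}(G)=\mathrm{conv}\{e_i+e_j : \{i,j\}\in E(G)\}\subseteq\mathbb{R}^n$, where $e_i$ is the $i$th unit vector. *)

(* Defs.v *)
From HB Require Import structures.
From mathcomp Require Import all_boot all_order all_algebra.
From mathcomp Require Import finmap.
From mathcomp Require Import mathcomp_extra boolp classical_sets functions.
From mathcomp Require Import cardinality reals exp convex.

Set Implicit Arguments.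
Unset Strict Implicit.
Unset Printing Implicit Defensive.

Import Order.TTheory GRing.Theory Num.Theory.

Local Open Scope classical_set_scope.
Local Open Scope ring_scope.

Section ConvexGeometry.
Variables (R : realType) (n : nat).
Implicit Types (S P F : set 'rV[R]_n).

Definition conv_hull S : set 'rV[R]_n := smallest (@convex_set R 'rV[R]_n) S.

(* A face is cut out by a valid inequality [c x <= b]; [set0] and [P] itself
   are faces, given by the inequalities [0 <= 1] and [0 <= 0]. *)
Definition is_face P F : Prop :=
  exists (c : 'cV[R]_n) (b : R),
    (forall x, P x -> (x *m c) 0 0 <= b) /\
    F = [set x | P x /\ (x *m c) 0 0 = b].

(* [x0 + U] is the affine hull of [F] and [k] is its dimension; the empty set
   has no dimension in this sense. *)
Definition has_dim F (k : nat) : Prop :=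
  exists (x0 : 'rV[R]_n) (U : {vspace 'rV[R]_n}),
    [/\ F x0,
        forall x, F x -> x - x0 \in U,
        forall V : {vspace 'rV[R]_n},
          (forall x, F x -> x - x0 \in V) -> (U <= V)%VS
      & \dim U = k].

(* [fset_set] sends infinite sets to the empty set; polytopes have only
   finitely many faces, so no such case arises for them. *)
Definition face_number (k : nat) P : nat :=
  #|` fset_set [set F | is_face P F /\ has_dim F k]|.

End ConvexGeometry.

Record sgraph (n : nat) := SGraph {
  adj : rel 'I_n;
  adj_sym : symmetric adj;
  adj_irrefl : irreflexive adj
}.

Definition no_isolated_vertex n (G : sgraph n) : Prop :=
  forall i, exists j, adj G i j.

Definition has_edge n (G : sgraph n) : Prop := exists i j, adj G i j.

Definition balanced_complete_bipartite n (G : sgraph n) : Prop :=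
  exists A : {set 'I_n},
    #|A| = #|~: A| /\ forall i j, adj G i j = ((i \in A) != (j \in A)).

Definition edge_polytope (R : realType) n (G : sgraph n) : set 'rV[R]_n :=
  conv_hull [set x | exists i j, adj G i j /\
                       x = delta_mx 0 i + delta_mx 0 j].

Arguments edge_polytope R {n} G.

(* Main.v *)
(* The vertices of the polytope are the edges of G, and two edges of G span an
   edge of the polytope unless they are opposite edges of a 4-cycle. Let m be
   the number of edges and e = ij an edge of G with end degrees p + 1 and q + 1.
   The vertex e of the polytope has at least p + q neighbours (the edges of G
   meeting e), and at most p q non-neighbours (each is of the form kl with k
   adjacent to i and l to j), so its degree D satisfies D >= p + q and
   D + 1 >= m - p q. By AM-GM this forces D >= 2 sqrt m - 2 for every single e,
   and summing over e gives the bound. In case of equality p = q = sqrt m - 1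
   and every neighbour of i is adjacent to every neighbour of j; these account
   for all m edges. *)
Require Import Defs.
From mathcomp Require Import finmap boolp classical_sets cardinality.
From mathcomp Require Import reals exp interval_inference convex.
(* Imported last: the finite-set lemmas must shadow the homonymous ones of
   [classical_sets]. *)
From mathcomp Require Import all_boot all_order all_algebra.
From mathcomp Require Import zify ring lra.

Set Implicit Arguments.
Unset Strict Implicit.
Unset Printing Implicit Defensive.

Import Order.TTheory GRing.Theory Num.Theory.

(** * Unordered pairs as two-element sets *)

Section TwoSets.
Variable T : finType.

Lemma eq_set2 (x y i j : T) :
  ([set x; y] == [set i; j]) =
  (x == i) && (y == j) || (x == j) && (y == i).
Proof.
apply/eqP/orP => [E|[]/andP[/eqP-> /eqP->]//]; last exact: setUC.
have := set21 x y; have := set22 x y; have := set21 i j; have := set22 i j.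
rewrite E -{1 2}E !inE.
by do 4 case/orP=> /eqP ?; subst; rewrite !eqxx; auto.
Qed.

(** Disjointness lets the ordered pair be recovered from the unordered one. *)
Lemma card_imset_pairs (A B : {set T}) : [disjoint A & B] ->
  #|[set [set p.1; p.2] | p in setX A B]| = #|A| * #|B|.
Proof.
move=> dAB; rewrite card_in_imset ?cardsX// => -[x y] [i j].
rewrite !inE /= => /andP[xA yB] /andP[iA jB] /eqP.
rewrite eq_set2 => /orP[]/andP[/eqP exi /eqP eyj]; first by rewrite exi eyj.
by have := disjointFr dAB iA; rewrite -eyj yB.
Qed.

(** Handshake count: each unordered pair comes from two ordered ones, distinct because [r] is
    irreflexive. *)
Lemma card_unordered_pairs (r : rel T) : symmetric r -> irreflexive r ->
  2 * #|[set [set p.1; p.2] | p : T * T & r p.1 p.2]| =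
  \sum_x #|[set y | r x y]|.
Proof.
move=> rS rI.
rewrite (eq_bigr (fun x => \sum_(y | r x y) 1)); last first.
  by move=> x _; rewrite sum1dep_card.
rewrite pair_big_dep /=.
rewrite (eq_bigl [in [set p | r p.1 p.2]]); last by move=> p; rewrite inE.
rewrite (partition_big_imset (fun p => [set p.1; p.2])) /=.
rewrite -[X in 2 * X]sum1_card big_distrr /=.
apply: eq_bigr => S /imsetP[[x y]]; rewrite !inE /= => rxy ->.
have nxy : x != y by apply: contraTneq rxy => ->; rewrite rI.
rewrite sum1dep_card.
(* The 2 becomes the size of the fibre over [[set x; y]]. *)
have -> : 2 * 1 = (((x, y) != (y, x)).+1) by rewrite xpair_eqE negb_and nxy.
rewrite -cards2; congr #|pred_of_set _|; apply/setP => -[u v].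
rewrite !inE /= eq_set2 !xpair_eqE.
by apply/idP/andP => [/orP[]/andP[/eqP-> /eqP->]|[_ ->//]];
  rewrite !eqxx ?orbT // rS.
Qed.

End TwoSets.

(** * Opposite edges, degrees in the graph of the polytope, extremal graphs *)

Section Graph.
Variables (n : nat) (G : sgraph n).
Implicit Types (i j k l x y : 'I_n) (e f g : {set 'I_n}).

Definition edges : {set {set 'I_n}} :=
  [set [set p.1; p.2] | p : 'I_n * 'I_n & adj G p.1 p.2].

Definition nbr i : {set 'I_n} := [set k | adj G i k].

Lemma edgesP e :
  reflect (exists i j, adj G i j /\ e = [set i; j]) (e \in edges).
Proof.
apply: (iffP imsetP) => [[[i j]]|[i [j [ij ->]]]].
  by rewrite inE /= => ij ->; exists i, j.
by exists (i, j); rewrite ?inE.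
Qed.

Lemma mem_edges i j : ([set i; j] \in edges) = adj G i j.
Proof.
apply/edgesP/idP => [[k [l [kl /eqP]]]|]; last by exists i, j.
by rewrite eq_set2 => /orP[]/andP[/eqP-> /eqP->] //; rewrite adj_sym.
Qed.

Lemma adj_neq i j : adj G i j -> i != j.
Proof. by apply: contraTneq => ->; rewrite adj_irrefl. Qed.

(* [e] and [f] are opposite edges of a 4-cycle of [G]. *)
Definition opposite e f := [exists i, exists j, exists k, exists l,
  [&& e == [set i; j], f == [set k; l], i != l, j != k,
      adj G i j, adj G k l, adj G i k & adj G j l]].

Lemma oppositeP e f : reflect (exists i j k l,
  [/\ e = [set i; j], f = [set k; l] & [&& i != l, j != k,
      adj G i j, adj G k l, adj G i k & adj G j l]]) (opposite e f).
Proof.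
apply: (iffP existsP) => [[i /existsP[j /existsP[k /existsP[l]]]]|].
  by case/and3P => /eqP-> /eqP-> h; exists i, j, k, l.
move=> [i [j [k [l [-> -> h]]]]]; exists i; apply/existsP; exists j.
by apply/existsP; exists k; apply/existsP; exists l; rewrite !eqxx.
Qed.

Lemma opposite_sym : symmetric opposite.
Proof.
move=> e f; wlog suff h : e f / opposite e f -> opposite f e.
  by apply/idP/idP; apply: h.
case/oppositeP => i [j [k [l [-> -> /and5P[il jk ij kl /andP[ik jl]]]]]].
apply/oppositeP; exists k, l, i, j; split=> //.
by rewrite eq_sym jk eq_sym il kl ij !(adj_sym G k, adj_sym G l) ik jl.
Qed.

Definition opposites e := [set f | opposite e f].

(** Swapping [i] and [j] in the 4-cycle swaps [k] and [l], so the labelling of the first edge may be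
    fixed. The bound p q on the number of opposites comes from this description. *)
Lemma opposites_set2 i j : adj G i j -> opposites [set i; j] =
  [set [set p.1; p.2] | p in
     [set p in setX (nbr i :\ j) (nbr j :\ i) | adj G p.1 p.2]].
Proof.
move=> ij; apply/setP => f; rewrite inE; apply/oppositeP/imsetP.
  move=> [i' [j' [k [l [/eqP]]]]]; rewrite eq_set2 => E -> h.
  case/orP: E => /andP[/eqP ei /eqP ej]; subst i' j'.
    case/and5P: h => il jk _ kl /andP[ik jl]; exists (k, l) => //.
    by rewrite !inE /= kl ik jl eq_sym jk eq_sym il.
  case/and5P: h => jl ik _ kl /andP[jk il]; exists (l, k) => /=;
    last exact: setUC.
  by rewrite !inE /= (adj_sym G l k) kl il jk (eq_sym l) jl (eq_sym k) ik.
move=> [[k l]]; rewrite !inE /=.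
move=> /andP[/andP[/andP[kj ik] /andP[li jl]] kl] ->.
by exists i, j, k, l; split=> //;
  rewrite (eq_sym i) li (eq_sym j) kj ij kl ik jl.
Qed.

Lemma card_nbrD1 i j : adj G i j -> #|nbr i :\ j|.+1 = #|nbr i|.
Proof. by move=> ij; rewrite (cardsD1 j (nbr i)) inE ij. Qed.

Lemma opposites_sub_edges e : opposites e \subset edges.
Proof.
apply/subsetP => f;
rewrite inE => /oppositeP[i [j [k [l [_ -> /and5P[_ _ _ kl _]]]]]].
by rewrite mem_edges.
Qed.

Lemma opposite_irrefl e : opposite e e = false.
Proof.
apply: contraTF isT => /oppositeP[i [j [k [l [-> /eqP]]]]].
rewrite eq_set2 => /orP[]/andP[/eqP-> /eqP->]; rewrite ?adj_irrefl ?andbF //.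
by rewrite eqxx.
Qed.

Lemma card_opposites_le i j : adj G i j ->
  #|opposites [set i; j]| <= #|nbr i :\ j| * #|nbr j :\ i|.
Proof.
move=> ij; rewrite opposites_set2 // -cardsX (leq_trans (leq_imset_card _ _)) //.
by apply: subset_leq_card; apply/subsetP => p; rewrite inE => /andP[].
Qed.

(* Adjacency in the graph of the polytope. *)
Definition skel e f :=
  [&& e \in edges, f \in edges, e != f & ~~ opposite e f].

Lemma skel_sym : symmetric skel.
Proof.
move=> e f; rewrite /skel opposite_sym eq_sym.
by case: (e \in edges) (f \in edges) => [] [].
Qed.

Lemma skel_irrefl : irreflexive skel.
Proof. by move=> e; rewrite /skel eqxx /= !andbF. Qed.

Definition skel_deg e := #|[set f | skel e f]|.

(** The edges other than [e] split into its opposites and its neighbours; the successor counts [e]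
    itself. *)
Lemma skel_degE e : e \in edges -> (skel_deg e + #|opposites e|).+1 = #|edges|.
Proof.
move=> eE; rewrite (cardsD1 e edges) eE add1n; congr S.
rewrite -(cardsID (opposites e) (edges :\ e)) addnC; congr addn.
  apply: eq_card => f; rewrite !inE; case E: (opposite e f); rewrite ?andbF //.
  rewrite (subsetP (opposites_sub_edges e)) ?inE // andbT.
  by apply/esym; case: eqVneq E => // ->; rewrite opposite_irrefl.
apply: eq_card => f; rewrite !inE /skel eE /= eq_sym.
by case: (opposite e f) (f \in edges) (f == e) => [] [] [].
Qed.

(** Another edge sharing an end with [[set i; j]] is not opposite to it, and none contains both
    ends, so the families at [i] and at [j] are disjoint. *)
Lemma skel_deg_ge i j : adj G i j ->
  #|nbr i :\ j| + #|nbr j :\ i| <= skel_deg [set i; j].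
Proof.
move=> ij; have nij := adj_neq ij; have ji : adj G j i by rewrite adj_sym.
pose A := [set [set i; k] | k in nbr i :\ j].
pose B := [set [set j; k] | k in nbr j :\ i].
have <- : #|A| = #|nbr i :\ j|.
  rewrite card_in_imset // => x y;
  rewrite !inE => /andP[xj _] /andP[yj ix] /eqP.
  by rewrite eq_set2 eqxx /= => /orP[/eqP//|/andP[/eqP-> /eqP->]].
have <- : #|B| = #|nbr j :\ i|.
  rewrite card_in_imset // => x y;
  rewrite !inE => /andP[xj _] /andP[yj ix] /eqP.
  by rewrite eq_set2 eqxx /= => /orP[/eqP//|/andP[/eqP-> /eqP->]].
have -> : #|A| + #|B| = #|A :|: B|.
  rewrite cardsU disjoint_setI0 ?cards0 ?subn0 //.
  rewrite disjoint_subset; apply/subsetP => _ /imsetP[x xi ->].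
  apply/negP => /imsetP[y]; rewrite !inE in xi *.
  case/andP: xi => xj ix /andP[yi jy] /eqP; rewrite eq_set2 (negPf nij) /=.
  by rewrite (negPf xj) andbF.
apply: subset_leq_card; apply/subsetP => f; rewrite inE => /orP[]/imsetP[x].
  rewrite !inE => /andP[xj ix] ->; rewrite /skel !mem_edges ij ix /=.
  rewrite eq_set2 eqxx (eq_sym j x) (negPf xj) (eq_sym j i) (negPf nij) !andbF
    /=.
  apply/negP => oe; have: [set i; x] \in opposites [set i; j] by rewrite inE.
  rewrite opposites_set2 // => /imsetP[[k l]]; rewrite !inE /=.
  move=> /andP[/andP[/andP[kj ik] /andP[li jl]] kl] /eqP; rewrite eq_set2.
  by case/orP=> /andP[/eqP e1 /eqP e2]; subst;
    rewrite ?adj_irrefl ?eqxx in ik li.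
rewrite !inE => /andP[xj ix] ->; rewrite /skel !mem_edges ij ix /=.
rewrite eq_set2 (negPf nij) (eq_sym i x) (negPf xj) /=.
apply/negP => oe; have: [set j; x] \in opposites [set i; j] by rewrite inE.
rewrite opposites_set2 // => /imsetP[[k l]]; rewrite !inE /=.
move=> /andP[/andP[/andP[kj ik] /andP[li jl]] kl] /eqP; rewrite eq_set2.
by case/orP=> /andP[/eqP e1 /eqP e2]; subst;
  rewrite ?adj_irrefl ?eqxx in kj jl.
Qed.

Lemma card_skel_pairs :
  2 * #|[set [set p.1; p.2] | p : {set 'I_n} * {set 'I_n} & skel p.1 p.2]| =
  \sum_(e in edges) skel_deg e.
Proof.
rewrite card_unordered_pairs; [|exact: skel_sym|exact: skel_irrefl].
rewrite [RHS]big_mkcond; apply: eq_bigr => e _; case: ifP => // eE.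
by apply/eqP; rewrite cards_eq0; apply/eqP/setP => f; rewrite !inE /skel eE.
Qed.

(** The number of opposites forces [nbr i] and [nbr j] to be completely joined. As there are no
    loops, they are disjoint, so by counting every edge runs between them; as no vertex is isolated,
    they cover all vertices. *)
Lemma balanced_of_tight i j a : no_isolated_vertex G -> adj G i j ->
  #|nbr i| = a -> #|nbr j| = a -> #|edges| = a ^ 2 ->
  #|opposites [set i; j]| = a.-1 ^ 2 -> balanced_complete_bipartite G.
Proof.
move=> hiso ij di dj dE dO; have ji : adj G j i by rewrite adj_sym.
have di' : #|nbr i :\ j| = a.-1 by rewrite -di -(card_nbrD1 ij).
have dj' : #|nbr j :\ i| = a.-1 by rewrite -dj -(card_nbrD1 ji).
pose X := setX (nbr i :\ j) (nbr j :\ i).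
have sX : [set p in X | adj G p.1 p.2] \subset X.
  by apply/subsetP => p; rewrite inE => /andP[].
(* The adjacent pairs have an image with as many elements as [X], so no pair of [X] is missing. *)
have eX : [set p in X | adj G p.1 p.2] = X.
  apply/eqP; rewrite -(geq_leqif (subset_leqif_cards sX)) cardsX di' dj' mulnn.
  by rewrite -dO opposites_set2 // leq_imset_card.
have adjX k l : adj G i k -> adj G j l -> adj G k l.
  move=> ik jl; case: (eqVneq k j) => [->//|kj]; case: (eqVneq l i) => [->|li].
    by rewrite adj_sym.
  have: (k, l) \in X by rewrite !inE /= kj ik li jl.
  by rewrite -eX inE => /andP[].
have dis : [disjoint nbr i & nbr j].
  rewrite disjoint_subset; apply/subsetP => x; rewrite !inE => ix.
  by apply/negP => jx; have := adjX _ _ ix jx; rewrite adj_irrefl.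
have EI : [set [set p.1; p.2] | p in setX (nbr i) (nbr j)] = edges.
  apply/eqP; rewrite eqEcard card_imset_pairs // di dj dE mulnn leqnn andbT.
  apply/subsetP => _ /imsetP[[k l] + ->]; rewrite !inE /= => /andP[ik jl].
  by rewrite mem_edges adjX.
have adjE x y : adj G x y ->
    (x \in nbr i) && (y \in nbr j) || (x \in nbr j) && (y \in nbr i).
  rewrite -mem_edges -EI => /imsetP[[k l]]; rewrite in_setX /= => /andP[ik jl].
  by move=> /eqP; rewrite eq_set2 => /orP[]/andP[/eqP-> /eqP->];
    rewrite ik jl ?orbT.
have nj : ~: nbr i = nbr j.
  apply/setP => x; rewrite inE; apply/idP/idP => [xi|xj].
    have [y xy] := hiso x; have := adjE _ _ xy.
    by rewrite (negPf xi) => /andP[].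
  by apply/negP => xi; rewrite (disjointFr dis xi) in xj.
have njE x : (x \in nbr j) = (x \notin nbr i) by rewrite -nj inE.
exists (nbr i); split; first by rewrite nj di dj.
move=> x y; apply/idP/idP => [/adjE|]; rewrite ?njE.
  by case: (x \in _) (y \in _) => [] [].
have [xi|xi] := boolP (x \in nbr i);
have [yi|yi] := boolP (y \in nbr i) => // _.
  by apply: adjX; [|rewrite -njE inE in yi]; rewrite ?inE // in xi.
by rewrite adj_sym; apply: adjX; [|rewrite -njE inE in xi];
  rewrite ?inE // in yi.
Qed.

(** With parts of size a, each edge has (a - 1)^2 opposites, hence degree a^2 - 1 - (a - 1)^2 = 2 a
    - 2; the [+ 2] avoids truncated subtraction. *)
Lemma edge_count_of_balanced : balanced_complete_bipartite G ->
  exists a, #|edges| = a ^ 2 /\ forall e, e \in edges -> skel_deg e + 2 = 2 * a.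
Proof.
case=> A [cA adjE].
have dA (B C : {set 'I_n}) : B \subset A -> C \subset ~: A -> [disjoint B & C].
  move=> BA CA; rewrite disjoint_subset; apply/subsetP => x /(subsetP BA) xA.
  by apply/negP => /(subsetP CA); rewrite inE xA.
have EE : edges = [set [set p.1; p.2] | p in setX A (~: A)].
  apply/setP => e; apply/edgesP/imsetP.
    move=> [x [y []]]; rewrite adjE => xy ->.
    case: (boolP (x \in A)) xy => xA; case: (boolP (y \in A)) => yA // _.
      by exists (x, y); rewrite // !inE xA yA.
    by exists (y, x); [rewrite !inE xA yA|rewrite setUC].
  move=> [[x y]]; rewrite !inE /= => /andP[xA yA] ->; exists x, y.
  by rewrite adjE xA (negPf yA).
have cE : #|edges| = #|A| ^ 2 by rewrite EE card_imset_pairs ?dA // -cA mulnn.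
exists #|A|; split=> // e eE.
move: (eE); rewrite {1}EE => /imsetP[[i j]]; rewrite !inE /= => /andP[iA jA] ee.
have ij : adj G i j by rewrite adjE iA (negPf jA).
have nA x : x \in A -> nbr x = ~: A.
  by move=> xA; apply/setP => y; rewrite !inE adjE xA; case: (y \in A).
have nB x : x \notin A -> nbr x = A.
  by move=> xA; apply/setP => y; rewrite !inE adjE (negPf xA); case: (y \in A).
have cO : #|opposites e| = #|A :\ i| * #|A :\ i|.
  have cAi : #|~: A :\ j| = #|A :\ i|.
    by have := cA; rewrite (cardsD1 i A) (cardsD1 j (~: A)) iA inE jA => -[].
  rewrite ee opposites_set2 // nA // nB //.
  rewrite -{1}cAi mulnC -card_imset_pairs; last by rewrite dA // subsetDl.
  congr #|pred_of_set _|; apply/setP => f; apply/imsetP/imsetP.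
    move=> [[k l]]; rewrite !inE /= => /andP[/andP[h1 h2] _] ->.
    by exists (l, k); [rewrite !inE /= h1 h2|rewrite setUC].
  move=> [[l k]]; rewrite !inE /= => /andP[/andP[li lA] /andP[kj kA]] ->.
  exists (k, l); last by rewrite setUC.
  by rewrite !inE /= li lA kj kA adjE lA (negPf kA).
have := skel_degE eE; rewrite cE cO (cardsD1 i A) iA.
by set d := #|_|; nia.
Qed.

(** * Faces with one or two vertices, cut out by explicit natural weights *)

Definition wt (w : 'I_n -> nat) e := \sum_(k in e) w k.

Lemma wt_set2 w x y : adj G x y -> wt w [set x; y] = w x + w y.
Proof. by move=> xy; rewrite /wt big_setU1 ?inE ?adj_neq // big_set1. Qed.

(* Some face of the polytope, with normal vector [w], has vertex set [S]. *)
Definition separable (S : {set {set 'I_n}}) := exists (w : 'I_n -> nat) b,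
  forall g, g \in edges -> (wt w g <= b) && ((wt w g == b) == (g \in S)).

Lemma separable_single e : e \in edges -> separable [set e].
Proof.
case/edgesP => i [j [ij ->]]; have nij := adj_neq ij.
exists (fun z => (z == i) + (z == j)), 2 => _ /edgesP[x [y [xy ->]]].
rewrite wt_set2 // inE eq_set2; have nxy := adj_neq xy.
have [?|xi] := eqVneq x i; have [?|xj] := eqVneq x j;
have [?|yi] := eqVneq y i; have [?|yj] := eqVneq y j; subst;
by rewrite ?eqxx in nij nxy *.
Qed.

Lemma separable_incident i j k : adj G i j -> adj G i k -> j != k ->
  separable [set [set i; j]; [set i; k]].
Proof.
move=> ij ik jk.
(* Weight 3 requires the end [i], of weight 2, and one of [j], [k], of weight 1. *)
exists (fun z => (z == i).*2 + (z == j) + (z == k)), 3.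
move=> _ /edgesP[x [y [xy ->]]].
rewrite wt_set2 // !inE !eq_set2; have nxy := adj_neq xy.
have nij := adj_neq ij; have nik := adj_neq ik.
have [?|xi] := eqVneq x i; have [?|xj] := eqVneq x j; have [?|xk] := eqVneq x k;
have [?|yi] := eqVneq y i; have [?|yj] := eqVneq y j; have [?|yk] := eqVneq y k;
subst; by rewrite ?eqxx in nij nik jk nxy *.
Qed.

(* Starting from the face spanned by [i, j, k, l], tilting the functional
   from [i] towards [j] removes all edges at [i] except [ij]. *)
Lemma separable_disjoint i j k l : adj G i j -> adj G k l ->
  i != k -> i != l -> j != k -> j != l -> ~~ adj G j k -> ~~ adj G j l ->
  separable [set [set i; j]; [set k; l]].
Proof.
move=> ij kl ik il jk jl ajk ajl.
exists (fun z => (z == i) + 3 * (z == j) + (z == k).*2 + (z == l).*2), 4.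
move=> _ /edgesP[x [y [xy ->]]].
rewrite wt_set2 // !inE !eq_set2; have nxy := adj_neq xy.
have nij := adj_neq ij; have nkl := adj_neq kl.
(* Only the pairs [jk] and [jl] would weigh more than 4, and they are not edges. *)
have xjk : ~~ ((x == j) && (y == k)).
  by apply: contraNN ajk => /andP[/eqP<- /eqP<-].
have xkj : ~~ ((y == j) && (x == k)).
  by apply: contraNN ajk => /andP[/eqP<- /eqP<-]; rewrite adj_sym.
have xjl : ~~ ((x == j) && (y == l)).
  by apply: contraNN ajl => /andP[/eqP<- /eqP<-].
have xlj : ~~ ((y == j) && (x == l)).
  by apply: contraNN ajl => /andP[/eqP<- /eqP<-]; rewrite adj_sym.
have [?|xi] := eqVneq x i; have [?|xj] := eqVneq x j;
have [?|xk] := eqVneq x k; have [?|xl] := eqVneq x l;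
try (by subst; rewrite ?eqxx in nij nkl ik il jk jl);
have [?|yi] := eqVneq y i; have [?|yj] := eqVneq y j;
have [?|yk] := eqVneq y k; have [?|yl] := eqVneq y l;
subst; by rewrite ?eqxx in nij nkl ik il jk jl nxy xjk xkj xjl xlj *.
Qed.

Lemma separable_pair e f : skel e f -> separable [set e; f].
Proof.
case/and4P => /edgesP[i [j [ij ->]]] /edgesP[k [l [kl ->]]].
rewrite eq_set2 negb_or !negb_and => nef nopp.
have ji : adj G j i by rewrite adj_sym.
have lk : adj G l k by rewrite adj_sym.
have [?|nik] := eqVneq i k.
  by subst k; rewrite eqxx /= in nef; apply: separable_incident => //;
    case/andP: nef.
have [?|nil] := eqVneq i l.
  subst l; rewrite eqxx /= in nef; rewrite (setUC [set k]).
  by apply: separable_incident => //; case/andP: nef.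
have [?|njk] := eqVneq j k.
  subst k; rewrite (setUC [set i]); apply: separable_incident => //.
have [?|njl] := eqVneq j l.
  subst l; rewrite (setUC [set i]) (setUC [set k]);
  apply: separable_incident => //.
(* Neither of the two ways to complete the disjoint edges to a 4-cycle is available. *)
have h1 : ~~ (adj G i k && adj G j l).
  apply: contraNN nopp => /andP[ik jl]; apply/oppositeP; exists i, j, k, l.
  by split=> //; rewrite nil njk ij kl ik jl.
have h2 : ~~ (adj G i l && adj G j k).
  apply: contraNN nopp => /andP[il jk]; apply/oppositeP; exists i, j, l, k.
  by split=> //; [rewrite setUC|rewrite nik njl ij lk il jk].
(* In each case the two missing pairs share a vertex ([i], [k], [l], [j] in turn), which takes the
   role of [j] in [separable_disjoint]. *)
move: h1 h2; rewrite !negb_and => /orP[ik|jl] /orP[il|jk].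
- by rewrite (setUC [set i]); apply: separable_disjoint.
- rewrite setUC (setUC [set k]); apply: separable_disjoint => //;
  rewrite 1?eq_sym // adj_sym //.
- rewrite setUC (setUC [set k]) (setUC [set l]);
  apply: separable_disjoint => //; rewrite 1?eq_sym // adj_sym //.
- by apply: separable_disjoint.
Qed.

End Graph.

Local Open Scope ring_scope.

(** * Faces of the edge polytope and the vertices they contain *)

Section Polytope.
Variables (R : realType) (n : nat) (G : sgraph n).
Implicit Types (e f g : {set 'I_n}) (F : set 'rV[R]_n) (S : {set {set 'I_n}}).

Local Notation P := (edge_polytope R G).
Local Notation edges := (edges G).

Definition vtx e : 'rV[R]_n := \row_k (k \in e)%:R.

Lemma vtx_set2 (i j : 'I_n) : i != j ->
  delta_mx 0 i + delta_mx 0 j = vtx [set i; j].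
Proof.
move=> nij; apply/rowP => k; rewrite !mxE !inE !eqxx /= -natrD.
by have [->|ki] := eqVneq k i; rewrite ?(negPf nij).
Qed.

Lemma vtx_inj : injective vtx.
Proof.
move=> e f /rowP E; apply/setP => k; have := E k; rewrite !mxE.
by case: (k \in e) (k \in f) => [] [] // /eqP;
  rewrite ?oner_eq0 // eq_sym oner_eq0.
Qed.

Lemma vtx_dot (c : 'cV[R]_n) e : (vtx e *m c) 0 0 = \sum_(k in e) c k 0.
Proof.
rewrite mxE [RHS]big_mkcond; apply: eq_bigr => k _; rewrite mxE.
by case: ifP; rewrite ?mul1r ?mul0r.
Qed.

Lemma polytope_vtx g : g \in edges -> P (vtx g).
Proof.
case/edgesP => i [j [ij ->]]; apply: sub_gen_smallest.
by exists i, j; rewrite vtx_set2 // (adj_neq ij).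
Qed.

Definition is_comb S (x : 'rV[R]_n) := exists a : {set 'I_n} -> R,
  [/\ forall g, 0 <= a g, \sum_(g in S) a g = 1
    & x = \sum_(g in S) a g *: vtx g].

(** The combinations form a convex set containing the generators, so minimality of the hull
    applies. *)
Lemma polytope_comb x : P x -> is_comb edges x.
Proof.
move: x; apply: smallest_sub; last first.
  move=> _ [i [j [ij ->]]]; exists (fun g => (g == [set i; j])%:R); split.
  - by move=> g; rewrite ler0n.
  - rewrite (bigD1 [set i; j]) ?mem_edges //= eqxx big1 ?addr0 //.
    by move=> g /andP[_ /negPf->].
  - rewrite (bigD1 [set i; j]) ?mem_edges //= eqxx scale1r big1 ?addr0.
      by rewrite vtx_set2 // (adj_neq ij).
    by move=> g /andP[_ /negPf->]; rewrite scale0r.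
move=> x y p /set_mem[a [a0 a1 ->]] /set_mem[b [b0 b1 ->]]; apply/mem_set.
exists (fun g => p%:num * a g + (1 - p%:num) * b g); split.
- by move=> g; rewrite addr_ge0 // mulr_ge0.
- by rewrite big_split /= -!mulr_sumr a1 b1 !mulr1 /unstable.onem subrKC.
- rewrite /conv /= !scaler_sumr -big_split /=; apply: eq_bigr => g _.
  by rewrite [RHS]scalerDl !scalerA.
Qed.

(** Faces are counted through their traces, which live in a finite type and determine the face
    ([trace_inj]). *)
Definition trace F := [set g in edges | `[< F (vtx g) >]].

Lemma in_trace F g : (g \in trace F) = (g \in edges) && `[< F (vtx g) >].
Proof. by rewrite inE. Qed.

Lemma comb_dot S (a : {set 'I_n} -> R) (c : 'cV[R]_n) :
  ((\sum_(g in S) a g *: vtx g) *m c) 0 0 =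
  \sum_(g in S) a g * (vtx g *m c) 0 0.
Proof.
rewrite mulmx_suml summxE; apply: eq_bigr => g _.
by rewrite -scalemxAl mxE.
Qed.

Lemma face_trace (c : 'cV[R]_n) b g :
  (g \in trace [set x | P x /\ (x *m c) 0 0 = b]%classic) =
  (g \in edges) && ((vtx g *m c) 0 0 == b).
Proof.
rewrite in_trace; case: (boolP (g \in edges)) => //= gE.
by apply/asboolP/eqP => [[]|] //= h; split=> //; exact: polytope_vtx.
Qed.

(** A valid inequality that is tight at a convex combination is tight at every vertex with nonzero
    coefficient. *)
Lemma faceP F : is_face P F ->
  forall x, F x <-> P x /\ is_comb (trace F) x.
Proof.
move=> [c [b [Pb FE]]] x; subst F; set T := trace _.
have vb g : g \in edges -> (vtx g *m c) 0 0 <= b by move/polytope_vtx/Pb.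
split=> /= [[Px xb]|[Px [a [a0 a1 xE]]]]; split=> //.
  have [a [a0 a1 xE]] := polytope_comb Px.
  (* The weighted slacks are nonnegative and sum to 0, so each of them vanishes. *)
  have a_out g : g \in edges -> g \notin T -> a g = 0.
    move=> gE gT; have : \sum_(g in edges) a g * (b - (vtx g *m c) 0 0) = 0.
      under eq_bigr do rewrite mulrBr.
      by rewrite sumrB -mulr_suml a1 mul1r -comb_dot -xE xb subrr.
    move=> /psumr_eq0P-/(_ _ g gE)/eqP; rewrite mulf_eq0 subr_eq0.
    case/(_ _)/orP => [h hE|/eqP//|/eqP bE].
      by rewrite mulr_ge0 // subr_ge0 vb.
    by rewrite /T face_trace gE -bE eqxx in gT.
  (* The target [V] is general so as to serve both the coefficients and the vectors. *)
  have restr (V : nmodType) (h : {set 'I_n} -> V) :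
      (forall g, a g = 0 -> h g = 0) ->
      \sum_(g in edges) h g = \sum_(g in T) h g.
    move=> h0; rewrite big_mkcond [RHS]big_mkcond; apply: eq_bigr => g _.
    have [gT|gT] := boolP (g \in T); first
      by move: gT; rewrite /T face_trace => /andP[-> _].
    by case: ifP => // gE; rewrite h0 ?a_out.
  exists a; split=> //; first by rewrite -restr.
  by rewrite -restr // => g ->; rewrite scale0r.
rewrite xE comb_dot.
rewrite (eq_bigr (fun g => a g * b)) -?mulr_suml ?a1 ?mul1r // => g.
by rewrite face_trace => /andP[_ /eqP->].
Qed.

Lemma trace_inj F1 F2 : is_face P F1 -> is_face P F2 -> trace F1 = trace F2 ->
  F1 = F2.
Proof.
move=> f1 f2 E; have h1 := faceP f1; have h2 := faceP f2.
by apply/funext => x; apply/propext; rewrite h1 h2 E.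
Qed.

Lemma face_vtx F g : g \in trace F -> F (vtx g).
Proof. by rewrite in_trace => /andP[_ /asboolP]. Qed.

Lemma face_number_card k (A : {set {set {set 'I_n}}}) :
  (forall F, is_face P F -> has_dim F k -> trace F \in A) ->
  (forall S, S \in A -> exists F, [/\ is_face P F, has_dim F k & trace F = S])
    ->
  face_number k P = #|A|.
Proof.
move=> FA AF.
pose h S := xget classical_sets.set0
  [set F | [/\ is_face P F, has_dim F k & trace F = S]]%classic.
have hP S : S \in A -> [/\ is_face P (h S), has_dim (h S) k & trace (h S) = S].
  by move=> SA; apply: (xgetPex classical_sets.set0 (AF S SA)).
rewrite /face_number.
have -> : [set F | is_face P F /\ has_dim F k]%classic =
          [set` [fset h S | S in A]%fset]%classic.
  apply/seteqP; split=> F /=.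
    move=> [Ff Fk]; apply/imfsetP; exists (trace F); first exact: FA.
    have [hf _ hT] := hP _ (FA _ Ff Fk); exact: trace_inj.
  by move=> /imfsetP[S /= SA ->]; have [] := hP S SA.
rewrite set_fsetK card_in_imfset /= -?cardE // => S1 S2 S1A S2A E.
by have [_ _ <-] := hP _ S1A; have [_ _ <-] := hP _ S2A; rewrite E.
Qed.

Lemma has_dim0_trace F : is_face P F -> has_dim F 0 ->
  exists2 e, e \in edges & trace F = [set e].
Proof.
move=> Ff [x0 [U [Fx0 FU _ /eqP]]]; rewrite dimv_eq0 => /eqP U0.
have FP := faceP Ff.
have [_ [a [_ a1 _]]] := (FP x0).1 Fx0.
(* Coefficients with sum 1 rule out an empty trace. *)
have [T0|[e eT]] := set_0Vmem (trace F).
  by move: a1; rewrite T0 big_set0 => /esym/eqP; rewrite oner_eq0.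
exists e; first by move: eT; rewrite in_trace => /andP[].
apply/setP => g; rewrite inE; apply/idP/eqP => [gT|->//].
have := FU _ (face_vtx gT); have := FU _ (face_vtx eT).
rewrite U0 !memv0 !subr_eq0 => /eqP E /eqP; rewrite -E; exact: vtx_inj.
Qed.

Lemma trace_has_dim0 F e : is_face P F -> trace F = [set e] -> has_dim F 0.
Proof.
move=> Ff E; have FP := faceP Ff; exists (vtx e), 0%VS; split.
- by apply: face_vtx; rewrite E inE.
- move=> x /FP[_ [a [_]]]; rewrite E !big_set1 => -> ->.
  by rewrite scale1r subrr mem0v.
- by move=> V _; rewrite sub0v.
- exact: dimv0.
Qed.

Lemma has_dim1_trace F : is_face P F -> has_dim F 1 ->
  exists e f, [/\ e \in edges, f \in edges, e != f & trace F = [set e; f]].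
Proof.
move=> Ff [x0 [U [Fx0 FU Umin dU]]]; have FP := faceP Ff.
have [_ [a [_ a1 x0E]]] := (FP x0).1 Fx0.
have [T0|[e eT]] := set_0Vmem (trace F).
  by move: a1; rewrite T0 big_set0 => /esym/eqP; rewrite oner_eq0.
have TE g : g \in trace F -> g \in edges by rewrite in_trace => /andP[].
have [/eqP|[f]] := set_0Vmem (trace F :\ e).
  rewrite setD_eq0 subset1 => /orP[/eqP E|/eqP E]; last by rewrite E inE in eT.
  (* With a single vertex the face is a point, and minimality of [U] contradicts dimension 1. *)
  have : (U <= 0)%VS.
    apply: Umin => x /FP[_ [b [_]]]; rewrite E big_set1 => b1 ->.
    rewrite E !big_set1 in a1 x0E *.
    by rewrite x0E a1 b1 subrr mem0v.
  by rewrite subv0 -dimv_eq0 dU.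
rewrite !inE => /and3P[nfe fE /asboolP Ff'];
have fT : f \in trace F by rewrite in_trace fE; apply/asboolP.
exists e, f; split; rewrite ?TE // 1?eq_sym //.
apply/setP => g; rewrite !inE -in_trace; apply/idP/orP => [gT|]; last first.
  by case=> /eqP->.
apply/orP; apply: contraT; rewrite negb_or => /andP[nge ngf].
(* Three distinct 0/1-vectors are never collinear. *)
have dir h : h \in trace F -> vtx h - vtx e \in U.
  move=> hT; rewrite -[vtx h](subrK x0) -addrA -[x0 - _]opprB; apply: memvB;
  apply: FU; exact: face_vtx.
have nz h : h != e -> vtx h - vtx e != 0.
  by move=> he; rewrite subr_eq0 (inj_eq vtx_inj).
have [s sE] : exists s, vtx g - vtx e = s *: (vtx f - vtx e).
  have /vlineP[s ->] : vtx g - vtx e \in <[vtx f - vtx e]>%VS; last by exists s.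
  suff -> : <[vtx f - vtx e]>%VS = U by apply: dir.
  apply/eqP; rewrite eqEdim dU dim_vline nz // andbT -memvE; exact: dir.
have [k kN] : exists k, (k \in f) != (k \in e).
  apply/existsP; apply: contraR nfe; rewrite negb_exists => /forallP h.
  by apply/eqP/setP => k; have := h k; rewrite negbK => /eqP.
(* At the coordinate [k], where [e] and [f] differ, the 0/1 entries leave only s = 0, meaning g = e,
   and s = 1, meaning g = f. *)
have s01 : s = 0 \/ s = 1.
  have /rowP/(_ k) := sE; rewrite !mxE.
  case: (k \in f) (k \in e) (k \in g) kN => [] [] [] //= _ h;
  [right|left|left|right]; lra.
case: s01 => sv; move: sE; rewrite sv.
  by rewrite scale0r => /eqP; rewrite (negPf (nz _ nge)).
by rewrite scale1r => /addIr/vtx_inj/eqP; rewrite (negPf ngf).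
Qed.

Lemma trace_has_dim1 F e f : is_face P F -> e != f -> trace F = [set e; f] ->
  has_dim F 1.
Proof.
move=> Ff nef E; have FP := faceP Ff.
exists (vtx e), <[vtx f - vtx e]>%VS; split.
- by apply: face_vtx; rewrite E !inE eqxx.
- move=> x /FP[_ [a [_]]]; rewrite E !big_setU1 ?inE // !big_set1 => a1 ->.
  have -> : a e *: vtx e + a f *: vtx f - vtx e = a f *: (vtx f - vtx e).
    by rewrite -[X in _ - X]scale1r -a1 scalerDl scalerBr opprD addrACA subrr
      add0r.
  by apply: memvZ; exact: memv_line.
- move=> V h; rewrite -memvE; apply: h; apply: face_vtx.
  by rewrite E !inE eqxx orbT.
- by rewrite dim_vline subr_eq0 (inj_eq vtx_inj) eq_sym nef.
Qed.

(** The inequality is linear, so its validity on [P] follows from its validity at the vertices. *)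
Lemma separable_face S : S \subset edges -> separable G S ->
  exists2 F, is_face P F & trace F = S.
Proof.
move=> SE [w [b h]]; pose c : 'cV[R]_n := \col_k (w k)%:R.
have dotE g : (vtx g *m c) 0 0 = (wt w g)%:R.
  by rewrite vtx_dot /wt natr_sum; apply: eq_bigr => k _; rewrite mxE.
exists [set x | P x /\ (x *m c) 0 0 = b%:R]%classic.
  exists c, b%:R; split=> // x /polytope_comb[a [a0 a1 ->]].
  rewrite comb_dot -[leRHS]mul1r -[X in X * _]a1 mulr_suml;
  apply: ler_sum => g gE.
  by rewrite ler_wpM2l // dotE ler_nat; have /andP[] := h g gE.
apply/setP => g; rewrite face_trace dotE eqr_nat.
have [gE|gE] := boolP (g \in edges); first by have /andP[_ /eqP] := h g gE.
by apply/esym/negbTE; apply: contra gE; apply: (subsetP SE).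
Qed.

(* If [ij] and [kl] are opposite in the 4-cycle [i, j, l, k], the segment they
   span has the same midpoint as the one spanned by [ik] and [jl]. *)
Lemma face_not_opposite F e f : is_face P F -> trace F = [set e; f] ->
  ~~ opposite G e f.
Proof.
move=> [c [b [Pb FE]]] E; apply/negP => /oppositeP[i [j [k [l [ee ff]]]]].
case/and5P => il jk ij kl /andP[ik jl].
have dot x y : adj G x y -> (vtx [set x; y] *m c) 0 0 = c x 0 + c y 0.
  by move=> xy; rewrite vtx_dot big_setU1 ?inE ?(adj_neq xy) // big_set1.
have le x y : adj G x y -> c x 0 + c y 0 <= b.
  by move=> xy; rewrite -dot //; apply: Pb; apply: polytope_vtx;
    rewrite mem_edges.
have tr x y : adj G x y -> ([set x; y] \in trace F) = (c x 0 + c y 0 == b).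
  by move=> xy; rewrite FE face_trace mem_edges xy dot.
have /eqP ijb : c i 0 + c j 0 == b by rewrite -tr // E ee !inE eqxx.
have /eqP klb : c k 0 + c l 0 == b by rewrite -tr // E ff !inE eqxx orbT.
(* The values at [ik] and [jl] add up to 2 b and neither exceeds b, so [ik] lies in the trace
   although it differs from [e] and [f]. *)
have ikb : c i 0 + c k 0 == b by have := le _ _ ik; have := le _ _ jl; lra.
move: ikb; rewrite -tr // E ee ff !inE !eq_set2 !eqxx /=.
by rewrite (eq_sym k j) (negPf jk) (eq_sym k i) (negPf il) (negPf (adj_neq ik))
  ?andbF.
Qed.

Lemma face_number0 : face_number 0 P = #|edges|.
Proof.
rewrite -(card_imset edges (@set1_inj _)); apply: face_number_card.
  move=> F Ff /(has_dim0_trace Ff)[e eE ->]; exact: imset_f.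
move=> _ /imsetP[e eE ->].
have [|F Ff FT] := separable_face _ (separable_single eE);
first by rewrite sub1set.
by exists F; split=> //; apply: trace_has_dim0 FT.
Qed.

(** The edges of the polytope are the [skel] pairs: [separable_pair] realises them,
    [face_not_opposite] excludes the others. *)
Lemma face_number1 :
  (2 * face_number 1 P)%N = (\sum_(e in edges) skel_deg G e)%N.
Proof.
rewrite -card_skel_pairs; congr (_ * _)%N; apply: face_number_card.
  move=> F Ff /(has_dim1_trace Ff)[e [f [eE fE nef FT]]].
  apply/imsetP; exists (e, f) => //.
  by rewrite inE /skel eE fE nef (face_not_opposite Ff FT).
move=> _ /imsetP[[e f] + ->]; rewrite inE /= => ef.
have [eE fE nef _] := and4P ef.
have [|F Ff FT] := separable_face _ (separable_pair ef).
  by apply/subsetP => g; rewrite !inE => /orP[]/eqP->.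
by exists F; split=> //; apply: trace_has_dim1 FT.
Qed.

End Polytope.

(** * Real inequalities and the lower bound on each degree *)

Lemma sqrt_bound (R : realFieldType) (s p q D O : R) :
  1 <= s -> 0 <= p -> 0 <= q -> p + q <= D -> O <= p * q ->
  D + O + 1 = s ^+ 2 ->
  2 * s - 2 <= D /\
  (D = 2 * s - 2 -> [/\ p = s - 1, q = s - 1 & O = (s - 1) ^+ 2]).
Proof.
move=> s1 p0 q0 pqD Opq DO.
have D0 : 0 <= D by lra.
have b0 : 0 <= 2 * s - 2 by lra.
have pq0 : 0 <= p + q by lra.
have pqD2 : (p + q) ^+ 2 <= D ^+ 2 by rewrite lerXn2r.
split=> [|DE].
  rewrite leNgt; apply/negP => Dlt.
  have : D ^+ 2 < (2 * s - 2) ^+ 2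
    by rewrite ltrXn2r // lt_eqF // (le_lt_trans D0).
  (* AM-GM gives 4 O <= (p + q)^2 <= D^2, so 4 s^2 = 4 D + 4 + 4 O <= (D + 2)^2, against D + 2 < 2
     s. *)
  have := sqr_ge0 (p - q); nra.
have OE : O = (s - 1) ^+ 2 by move: DO; rewrite DE => h; lra.
(* (p - q)^2 = (p + q)^2 - 4 p q <= D^2 - 4 O = 0. *)
have pq : p = q.
  apply/eqP; rewrite -subr_eq0 -sqrf_eq0 eq_le sqr_ge0 andbT.
  move: pqD2 Opq; rewrite OE DE; nra.
(* Now 2 p <= D = 2 (s - 1), while p^2 = p q >= O = (s - 1)^2. *)
have ps : p = s - 1.
  have ps1 : p <= s - 1 by lra.
  have s0 : 0 <= s - 1 by lra.
  apply/eqP; rewrite eq_le ps1 -(@ler_pXn2r _ 2) //.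
  by rewrite -OE expr2 {2}pq.
by rewrite -pq.
Qed.

Lemma powR_three_halves (R : realType) (m : R) : 0 <= m ->
  m `^ (3 / 2) = m * Num.sqrt m.
Proof.
move=> m0; have -> : 3 / 2 = 1 + 2^-1 :> R by lra.
rewrite powRD ?powRr1 ?powR12_sqrt //.
by apply/implyP => /eqP h; exfalso; lra.
Qed.

Section SkeletonDegree.
Variables (R : rcfType) (n : nat) (G : sgraph n).
Let s : R := Num.sqrt #|edges G|%:R.

Lemma sqr_sqrt_edges : s ^+ 2 = #|edges G|%:R.
Proof. by rewrite sqr_sqrtr ?ler0n. Qed.

Lemma sqrt_edges_ge1 e : e \in edges G -> 1 <= s.
Proof.
move=> eE; rewrite -[leLHS]sqrtr1 ler_wsqrtr // ler1n.
by apply/card_gt0P; exists e.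
Qed.

Lemma skel_deg_real e : e \in edges G ->
  (skel_deg G e)%:R + #|opposites G e|%:R + 1 = s ^+ 2 :> R.
Proof. by move=> eE; rewrite sqr_sqrt_edges -(skel_degE eE) -addn1 !natrD. Qed.

Lemma skel_deg_ge_sqrt e : e \in edges G -> 2 * s - 2 <= (skel_deg G e)%:R.
Proof.
move=> eE; have [i [j [ij ee]]] := edgesP _ _ eE.
have [//|//|||//] := sqrt_bound (sqrt_edges_ge1 eE) _ _ _ _ (skel_deg_real eE)
  (p := #|nbr G i :\ j|%:R) (q := #|nbr G j :\ i|%:R).
- by rewrite ee -natrD ler_nat skel_deg_ge.
- by rewrite ee -natrM ler_nat card_opposites_le.
Qed.

Lemma skel_deg_eq_sqrt i j : no_isolated_vertex G -> adj G i j ->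
  (skel_deg G [set i; j])%:R = 2 * s - 2 -> balanced_complete_bipartite G.
Proof.
move=> hiso ij DE; have ji : adj G j i by rewrite adj_sym.
have eE : [set i; j] \in edges G by rewrite mem_edges.
have [//|//|||_ /(_ DE)[p q o]] :=
  sqrt_bound (sqrt_edges_ge1 eE) _ _ _ _ (skel_deg_real eE)
  (p := #|nbr G i :\ j|%:R) (q := #|nbr G j :\ i|%:R).
- by rewrite -natrD ler_nat skel_deg_ge.
- by rewrite -natrM ler_nat card_opposites_le.
have dij : #|nbr G j :\ i| = #|nbr G i :\ j|.
  by apply/eqP; rewrite -(eqr_nat R) p q.
(* Since p = s - 1 omits the neighbour [j], the full degree of [i] is s, the square root of the
   number of edges. *)
apply: (balanced_of_tight (a := #|nbr G i|) hiso ij) => //.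
- by rewrite -(card_nbrD1 ji) dij (card_nbrD1 ij).
- apply/eqP; rewrite -(eqr_nat R) natrX -sqr_sqrt_edges -(card_nbrD1 ij).
  by rewrite -natr1 p subrK.
by apply/eqP; rewrite -(eqr_nat R) o natrX -(card_nbrD1 ij) /= p.
Qed.

End SkeletonDegree.

(** * Summation over the edges of [G], and the equality case *)

Theorem theorem3p3 (R : realType) (n : nat) (G : sgraph n)
    (hiso : no_isolated_vertex G) (hedge : has_edge G) :
  let f0 : R := (face_number 0 (edge_polytope R G))%:R in
  let f1 : R := (face_number 1 (edge_polytope R G))%:R in
  f0 `^ (3 / 2) - f0 <= f1 /\
  (f0 `^ (3 / 2) - f0 = f1 <-> balanced_complete_bipartite G).
Proof.
move=> f0 f1; rewrite /f0 face_number0 powR_three_halves ?ler0n //.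
set s := Num.sqrt _; set lhs := (X in X <= _).
have sE : s ^+ 2 = #|edges G|%:R := sqr_sqrt_edges R G.
(* There are s^2 edges, so the terms 2 s - 2 add up to 2 (s^3 - s^2), twice [lhs]. *)
have excess : 2 * (f1 - lhs) =
    \sum_(e in edges G) ((skel_deg G e)%:R - (2 * s - 2)).
  rewrite sumrB sumr_const -[(2 * s - 2) *+ _]mulr_natl -sE -natr_sum
    -(face_number1 R) natrM.
  by rewrite /lhs -sE /f1; ring.
have term_ge0 e : e \in edges G -> 0 <= (skel_deg G e)%:R - (2 * s - 2).
  by move=> eE; rewrite subr_ge0 skel_deg_ge_sqrt.
split.
  by rewrite -subr_ge0 -(pmulr_rge0 _ (ltr0Sn R 1)) excess sumr_ge0.
split=> [E|/edge_count_of_balanced[a [mE DE]]].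
  (* A zero sum of nonnegative terms has only zero terms, and one tight edge already determines the
     graph. *)
  have [i [j ij]] := hedge.
  apply: (skel_deg_eq_sqrt (R := R) hiso ij); apply/eqP; rewrite -subr_eq0.
  apply/eqP; apply: (psumr_eq0P (P := mem (edges G)) term_ge0);
  last by rewrite inE mem_edges.
  by rewrite -excess -E subrr mulr0.
(* With s = a, every degree equals 2 s - 2 and the excess vanishes. *)
have sa : s = a%:R by rewrite /s mE natrX sqrtr_sqr ger0_norm.
have : 2 * (f1 - lhs) = 0.
  rewrite excess big1 // => e /DE /(congr1 (fun k => k%:R : R)).
  by rewrite sa natrD natrM => ?; lra.
by rewrite /lhs => ?; lra.
Qed.
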